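(* Let $\mathcal{C}$ be a monoidal category whose unit object $\underline{1}$ is a projective object. Then an algebra $A$ in $\mathcal{C}$ is separable if and only if $A$ is projective as an $A$-bimodule (that is, a projective object of the category ${}_A\mathcal{C}_A$ of $A$-bimodules in $\mathcal{C}$).
   Context: Monoidal categories are taken strict, with tensor product $\otimes$ and unit object $\underline{1}$. For an algebra $A$ with multiplication $m_A$, the objects $A$ and $A\otimes A$ are $A$-bimodules via $m_A$. An algebra $A$ is separable if there is a morphism $\gamma:A\to A\otimes A$ of $A$-bimodules with $m_A\gamma=\mathrm{Id}_A$.
   Formalization: The direction ''separable implies projective as an A-bimodule'' is proved under the added assumption that every epimorphism of A-bimodules is an epimorphism in C; without it that direction fails in a general monoidal category. The converse needs no extra assumption. *)

(* Defs.v *)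
(* Plain Stdlib development; proof irrelevance is used to treat bimodule
   morphisms as a subtype of the morphisms of C, and to identify any two
   equality proofs between the same objects. *)
From Stdlib Require Import ssreflect ProofIrrelevance.

Set Implicit Arguments.
Unset Strict Implicit.
Unset Printing Implicit Defensive.

Record category := Category {
  obj :> Type;
  hom : obj -> obj -> Type;
  idm : forall X : obj, hom X X;
  comp : forall X Y Z : obj, hom Y Z -> hom X Y -> hom X Z;
  comp_idl : forall (X Y : obj) (f : hom X Y), comp (idm Y) f = f;
  comp_idr : forall (X Y : obj) (f : hom X Y), comp f (idm X) = f;
  compA : forall (X Y Z W : obj) (f : hom Z W) (g : hom Y Z) (h : hom X Y),
    comp f (comp g h) = comp (comp f g) h
}.

Arguments hom {c} X Y.
Arguments idm {c} X.
Arguments comp {c X Y Z} f g.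

Declare Scope cat_scope.
Delimit Scope cat_scope with cat.
Open Scope cat_scope.

Notation "f '\oc' g" := (comp f g) (at level 50, left associativity) : cat_scope.

Definition is_epi (C : category) (X Y : C) (p : hom X Y) : Prop :=
  forall (Z : C) (g h : hom Y Z), g \oc p = h \oc p -> g = h.

Definition projective (C : category) (P : C) : Prop :=
  forall (X Y : C) (p : hom X Y), is_epi p ->
  forall f : hom P Y, exists g : hom P X, p \oc g = f.

(* In a strict monoidal category (X * Y) * Z and X * (Y * Z) are equal, but not
   convertible, objects; [eqm e] is the identity morphism read along e. *)
Definition eqm (C : category) (X Y : C) (e : X = Y) : hom X Y :=
  match e in _ = Y0 return hom X Y0 with eq_refl => idm X end.

(* The last three axioms say that the associativity and unit equalities also
   hold for morphisms: the two sides agree up to the identity morphisms between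
   their equal sources and targets. *)
Record strict_monoidal := StrictMonoidal {
  ucat :> category;
  tens : ucat -> ucat -> ucat;
  tensm : forall X X' Y Y' : ucat,
    hom X X' -> hom Y Y' -> hom (tens X Y) (tens X' Y');
  one : ucat;
  tensm_id : forall X Y : ucat, tensm (idm X) (idm Y) = idm (tens X Y);
  tensm_comp : forall (X X' X'' Y Y' Y'' : ucat)
    (f' : hom X' X'') (f : hom X X') (g' : hom Y' Y'') (g : hom Y Y'),
    tensm (f' \oc f) (g' \oc g) = tensm f' g' \oc tensm f g;
  tensA : forall X Y Z : ucat, tens (tens X Y) Z = tens X (tens Y Z);
  tens1l : forall X : ucat, tens one X = X;
  tens1r : forall X : ucat, tens X one = X;
  tensmA : forall (X X' Y Y' Z Z' : ucat)
    (f : hom X X') (g : hom Y Y') (h : hom Z Z'),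
    eqm (tensA X' Y' Z') \oc tensm (tensm f g) h
    = tensm f (tensm g h) \oc eqm (tensA X Y Z);
  tensm1l : forall (X X' : ucat) (f : hom X X'),
    eqm (tens1l X') \oc tensm (idm one) f = f \oc eqm (tens1l X);
  tensm1r : forall (X X' : ucat) (f : hom X X'),
    eqm (tens1r X') \oc tensm f (idm one) = f \oc eqm (tens1r X)
}.

Arguments tens {s} X Y.
Arguments tensm {s X X' Y Y'} f g.
Arguments one {s}.

Notation "X '\ox' Y" := (tens X Y) (at level 40, left associativity) : cat_scope.
Notation "f '\om' g" := (tensm f g) (at level 40, left associativity) : cat_scope.

Record algebra (C : strict_monoidal) := Algebra {
  acar :> C;
  mul : hom (acar \ox acar) acar;
  unit : hom one acar;
  mulA : mul \oc (mul \om idm acar)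
         = mul \oc (idm acar \om mul) \oc eqm (tensA acar acar acar);
  mul1l : mul \oc (unit \om idm acar) = eqm (tens1l acar);
  mul1r : mul \oc (idm acar \om unit) = eqm (tens1r acar)
}.

Arguments mul {C} a.
Arguments unit {C} a.

Record bimodule (C : strict_monoidal) (A : algebra C) := Bimodule {
  bcar :> C;
  lact : hom (A \ox bcar) bcar;
  ract : hom (bcar \ox A) bcar;
  lactA : lact \oc (mul A \om idm bcar)
          = lact \oc (idm A \om lact) \oc eqm (tensA A A bcar);
  lact1 : lact \oc (unit A \om idm bcar) = eqm (tens1l bcar);
  ractA : ract \oc (ract \om idm A)
          = ract \oc (idm bcar \om mul A) \oc eqm (tensA bcar A A);
  ract1 : ract \oc (idm bcar \om unit A) = eqm (tens1r bcar);
  lractA : ract \oc (lact \om idm A)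
           = lact \oc (idm A \om ract) \oc eqm (tensA A bcar A)
}.

Arguments lact {C A} b.
Arguments ract {C A} b.

Definition is_bimodule_morphism (C : strict_monoidal) (A : algebra C)
    (M N : bimodule A) (f : hom (bcar M) (bcar N)) : Prop :=
  f \oc lact M = lact N \oc (idm A \om f) /\
  f \oc ract M = ract N \oc (f \om idm A).

Definition bimod_hom (C : strict_monoidal) (A : algebra C)
    (M N : bimodule A) : Type :=
  {f : hom (bcar M) (bcar N) | is_bimodule_morphism f}.

Section BimoduleCategory.
Variables (C : strict_monoidal) (A : algebra C).

Lemma bimod_id_subproof (M : bimodule A) :
  is_bimodule_morphism (idm (bcar M)).
Proof. by split; rewrite tensm_id comp_idl comp_idr. Qed.

Definition bimod_id (M : bimodule A) : bimod_hom M M :=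
  exist _ (idm (bcar M)) (bimod_id_subproof M).

Lemma bimod_comp_subproof (M N P : bimodule A)
    (f : bimod_hom N P) (g : bimod_hom M N) :
  is_bimodule_morphism (proj1_sig f \oc proj1_sig g).
Proof.
case: f g => f [fl fr] [g [gl gr]]; split => /=.
- by rewrite -compA gl compA fl -compA -tensm_comp comp_idl.
- by rewrite -compA gr compA fr -compA -tensm_comp comp_idl.
Qed.

Definition bimod_comp (M N P : bimodule A)
    (f : bimod_hom N P) (g : bimod_hom M N) : bimod_hom M P :=
  exist _ (proj1_sig f \oc proj1_sig g) (bimod_comp_subproof f g).

Lemma bimod_hom_inj (M N : bimodule A) (f g : bimod_hom M N) :
  proj1_sig f = proj1_sig g -> f = g.
Proof. by case: f g => f fP [g gP] /= e; apply: subset_eq_compat. Qed.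

Lemma bimod_comp_idl (M N : bimodule A) (f : bimod_hom M N) :
  bimod_comp (bimod_id N) f = f.
Proof. by apply: bimod_hom_inj; apply: comp_idl. Qed.

Lemma bimod_comp_idr (M N : bimodule A) (f : bimod_hom M N) :
  bimod_comp f (bimod_id M) = f.
Proof. by apply: bimod_hom_inj; apply: comp_idr. Qed.

Lemma bimod_compA (M N P Q : bimodule A)
    (f : bimod_hom P Q) (g : bimod_hom N P) (h : bimod_hom M N) :
  bimod_comp f (bimod_comp g h) = bimod_comp (bimod_comp f g) h.
Proof. by apply: bimod_hom_inj; apply: compA. Qed.

Definition bimod_cat : category :=
  @Category (bimodule A) (@bimod_hom C A) bimod_id bimod_comp
    bimod_comp_idl bimod_comp_idr bimod_compA.

End BimoduleCategory.

Section EqmTheory.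
Variable C : strict_monoidal.

Lemma eqm_irr (X Y : C) (e e' : X = Y) : eqm e = eqm e'.
Proof. by rewrite (proof_irrelevance _ e e'). Qed.

Lemma eqm_id (X : C) (e : X = X) : eqm e = idm X.
Proof. by rewrite (eqm_irr e eq_refl). Qed.

Lemma eqm_comp (X Y Z : C) (e : X = Y) (e' : Y = Z) :
  eqm e' \oc eqm e = eqm (eq_trans e e').
Proof. by case: Z / e' => /=; rewrite comp_idl. Qed.

Lemma eqm_tensl (X Y Z : C) (e : X = Y) :
  eqm e \om idm Z = eqm (f_equal (fun T => T \ox Z) e).
Proof. by case: Y / e => /=; rewrite tensm_id. Qed.

Lemma eqm_tensr (X Y Z : C) (e : X = Y) :
  idm Z \om eqm e = eqm (f_equal (fun T => Z \ox T) e).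
Proof. by case: Y / e => /=; rewrite tensm_id. Qed.

Lemma tensmAl (X X' Y Y' Z Z' : C) (f : hom X X') (g : hom Y Y') (h : hom Z Z')
    (e' : X' \ox Y' \ox Z' = X' \ox (Y' \ox Z')) :
  eqm e' \oc (f \om g \om h) = (f \om (g \om h)) \oc eqm (tensA X Y Z).
Proof. by rewrite (eqm_irr e' (tensA X' Y' Z')) tensmA. Qed.

Lemma tensmAr (X X' Y Y' Z Z' : C) (f : hom X X') (g : hom Y Y') (h : hom Z Z')
    (e' : X' \ox (Y' \ox Z') = X' \ox Y' \ox Z') :
  eqm e' \oc (f \om (g \om h)) = (f \om g \om h) \oc eqm (eq_sym (tensA X Y Z)).
Proof.
rewrite -[LHS]comp_idr -(eqm_id (eq_trans (eq_sym (tensA X Y Z)) (tensA X Y Z))).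
rewrite -eqm_comp compA -(compA (eqm e')) -tensmA compA eqm_comp.
by rewrite eqm_id comp_idl.
Qed.

Lemma tensm_compl (X X' X'' Y : C) (f : hom X' X'') (g : hom X X') :
  (f \oc g) \om idm Y = (f \om idm Y) \oc (g \om idm Y).
Proof. by rewrite -tensm_comp comp_idl. Qed.

Lemma tensm_compr (X Y Y' Y'' : C) (f : hom Y' Y'') (g : hom Y Y') :
  idm X \om (f \oc g) = (idm X \om f) \oc (idm X \om g).
Proof. by rewrite -tensm_comp comp_idl. Qed.

End EqmTheory.

(* A as an A-bimodule via the multiplication. *)
Section RegularBimodule.
Variables (C : strict_monoidal) (A : algebra C).

Definition reg_bimod : bimodule A :=
  @Bimodule C A (acar A) (mul A) (mul A)
    (mulA A) (mul1l A) (mulA A) (mul1r A) (mulA A).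

(* A * A with actions m * A on the left and A * m on the right. *)
Definition free_lact : hom (A \ox (A \ox A)) (A \ox A) :=
  (mul A \om idm A) \oc eqm (eq_sym (tensA A A A)).

Definition free_ract : hom ((A \ox A) \ox A) (A \ox A) :=
  (idm A \om mul A) \oc eqm (tensA A A A).

Lemma free_lactA : free_lact \oc (mul A \om idm (A \ox A))
  = free_lact \oc (idm A \om free_lact) \oc eqm (tensA A A (A \ox A)).
Proof.
rewrite /free_lact -(compA _ _ (mul A \om _)) -tensm_id tensmAr compA.
rewrite -tensm_compl mulA !tensm_compl eqm_tensl -(compA _ (eqm _) (eqm _)) eqm_comp.
rewrite tensm_compr eqm_tensr -!compA.
rewrite (compA (eqm (eq_sym (tensA A A A))) (idm A \om (mul A \om idm A))).
rewrite tensmAr -!compA !eqm_comp.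
by do 2 apply: (f_equal (comp _)); apply: eqm_irr.
Qed.

Lemma free_lact1 :
  free_lact \oc (unit A \om idm (A \ox A)) = eqm (tens1l (A \ox A)).
Proof.
rewrite /free_lact -compA -tensm_id tensmAr compA -tensm_compl mul1l.
by rewrite eqm_tensl eqm_comp; apply: eqm_irr.
Qed.

Lemma free_ractA : free_ract \oc (free_ract \om idm A)
  = free_ract \oc (idm (A \ox A) \om mul A) \oc eqm (tensA (A \ox A) A A).
Proof.
rewrite /free_ract tensm_compl eqm_tensl -!compA -(tensm_id A A).
rewrite (compA (eqm _) (idm A \om idm A \om mul A)) tensmAl.
rewrite (compA (eqm _) (idm A \om mul A \om idm A)) tensmAl.
rewrite !compA -!tensm_compr mulA !tensm_compr eqm_tensr -!compA !eqm_comp.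
by do 2 apply: (f_equal (comp _)); apply: eqm_irr.
Qed.

Lemma free_ract1 :
  free_ract \oc (idm (A \ox A) \om unit A) = eqm (tens1r (A \ox A)).
Proof.
rewrite /free_ract -compA -tensm_id tensmAl compA -tensm_compr mul1r.
by rewrite eqm_tensr eqm_comp; apply: eqm_irr.
Qed.

Lemma free_lractA : free_ract \oc (free_lact \om idm A)
  = free_lact \oc (idm A \om free_ract) \oc eqm (tensA A (A \ox A) A).
Proof.
rewrite /free_ract /free_lact tensm_compl tensm_compr eqm_tensl eqm_tensr -!compA.
rewrite (compA (eqm _) (mul A \om idm A \om idm A)) tensmAl.
rewrite (compA (eqm _) (idm A \om (idm A \om mul A))) tensmAr.
rewrite !compA !tensm_id -!tensm_comp !comp_idl !comp_idr -!compA !eqm_comp.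
by apply: (f_equal (comp _)); apply: eqm_irr.
Qed.

Definition free_bimod : bimodule A :=
  @Bimodule C A (A \ox A) free_lact free_ract
    free_lactA free_lact1 free_ractA free_ract1 free_lractA.

End RegularBimodule.

Definition separable (C : strict_monoidal) (A : algebra C) : Prop :=
  exists gamma : bimod_hom (reg_bimod A) (free_bimod A),
    mul A \oc proj1_sig gamma = idm A.

(* The forgetful functor from A-bimodules to C preserves epimorphisms.  This is
   not automatic for an arbitrary C; it holds for instance when C has pushouts
   and they are preserved by the tensor product in each variable. *)
Definition forget_preserves_epi (C : strict_monoidal) (A : algebra C) : Prop :=
  forall (M N : bimod_cat A) (p : hom M N),
    is_epi p -> @is_epi C (bcar M) (bcar N) (proj1_sig p).

(* Main.v *)
(* Multiplication A * A -> A is a bimodule morphism which the unit of A splits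
   as a morphism of C, so it is an epimorphism, and it splits over bimodules
   when A is projective.  Conversely, a bimodule morphism A * A -> M is freely
   determined by a morphism 1 -> M, so projectivity of 1 allows one to lift
   bimodule morphisms out of A * A; a splitting of the multiplication makes A a
   retract of A * A, and liftings from A follow. *)
From Stdlib Require Import ssreflect.
Require Import Defs.

Set Implicit Arguments.
Unset Strict Implicit.
Unset Printing Implicit Defensive.

Lemma split_epi (C : category) (X Y : C) (p : hom X Y) (s : hom Y X) :
  p \oc s = idm Y -> is_epi p.
Proof.
by move=> ps Z g h gph; rewrite -(comp_idr g) -(comp_idr h) -ps !compA gph.
Qed.

Lemma tens1r_inv_nat (C : strict_monoidal) (X X' : C) (f : hom X X') :
  eqm (eq_sym (tens1r X')) \oc f
  = (f \om idm one) \oc eqm (eq_sym (tens1r X)).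
Proof.
rewrite -[f in LHS]comp_idr -(eqm_id (eq_trans (eq_sym (tens1r X)) (tens1r X))).
by rewrite -eqm_comp (compA f) -tensm1r !compA eqm_comp eqm_id comp_idl.
Qed.

Lemma tensm_idl_swap (C : strict_monoidal) (X X' Y Y' : C)
    (f : hom X X') (g : hom Y Y') :
  (f \om idm Y') \oc (idm X \om g) = (idm X' \om g) \oc (f \om idm Y).
Proof. by rewrite -!tensm_comp !comp_idl !comp_idr. Qed.

Section Bimodules.
Variables (C : strict_monoidal) (A : algebra C).

(** The forgetful functor to [C] is faithful. *)
Lemma forget_reflects_epi (M N : bimod_cat A) (p : hom M N) :
  @is_epi C (bcar M) (bcar N) (proj1_sig p) -> is_epi p.
Proof.
move=> p_epi Z g h /(f_equal (@proj1_sig _ _)) gph.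
by apply: bimod_hom_inj; apply: p_epi.
Qed.

Lemma mul_bimodule_morphism :
  @is_bimodule_morphism C A (free_bimod A) (reg_bimod A) (mul A).
Proof.
split; rewrite /= /free_lact /free_ract compA ?mulA //.
by rewrite -compA eqm_comp eqm_id comp_idr.
Qed.

Definition mul_bimod : bimod_hom (free_bimod A) (reg_bimod A) :=
  exist _ (mul A) mul_bimodule_morphism.

Lemma mul_bimod_epi :
  @is_epi (bimod_cat A) (free_bimod A) (reg_bimod A) mul_bimod.
Proof.
apply: forget_reflects_epi.
(* The section $a \mapsto 1 \otimes a$ need not be left linear, so the splitting takes place in
   [C]. *)
apply: (@split_epi C _ _ _ ((unit A \om idm A) \oc eqm (eq_sym (tens1l A)))).
by rewrite /= compA mul1l eqm_comp eqm_id.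
Qed.

(** The map $a \mapsto a \cdot h$ out of the free left module on [one]. *)
Definition lact_ext (M : bimodule A) (h : hom one (bcar M)) : hom A (bcar M) :=
  lact M \oc (idm A \om h) \oc eqm (eq_sym (tens1r A)).

Lemma lact_ext_mul (M : bimodule A) (h : hom one (bcar M)) :
  lact_ext h \oc mul A = lact M \oc (idm A \om lact_ext h).
Proof.
rewrite /lact_ext -compA tens1r_inv_nat !compA -(compA (lact M)).
rewrite -tensm_idl_swap !compA lactA !tensm_compr eqm_tensr !compA.
rewrite -(compA _ (eqm _) (idm _ \om h)) -tensm_id tensmAl.
by rewrite -!compA eqm_comp; do 3 apply: (f_equal (comp _)); apply: eqm_irr.
Qed.

Lemma lact_ext_comp (M N : bimodule A) (p : bimod_hom M N)
    (h : hom one (bcar M)) :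
  proj1_sig p \oc lact_ext h = lact_ext (proj1_sig p \oc h).
Proof.
by case: p => p [pl pr]; rewrite /lact_ext /= !compA pl tensm_compr !compA.
Qed.

(** A left linear map out of [A] is determined by its value at the unit, since $f(a) = a \cdot
    f(1)$. *)
Lemma lact_ext_unit (N : bimodule A) (f : bimod_hom (reg_bimod A) N) :
  lact_ext (proj1_sig f \oc unit A) = proj1_sig f.
Proof.
rewrite -lact_ext_comp /lact_ext /= mul1r.
by rewrite eqm_comp eqm_id comp_idr.
Qed.

(** The map is $a \otimes b \mapsto (a \cdot h) \cdot b$. Left linearity comes from that of
    [lact_ext h] and from [lractA], right linearity from [ractA]. *)
Lemma free_ext_bimodule_morphism (M : bimodule A) (h : hom one (bcar M)) :
  @is_bimodule_morphism C A (free_bimod A) M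
    (ract M \oc (lact_ext h \om idm A)).
Proof.
split; rewrite /= /free_lact /free_ract.
- rewrite !compA -(compA (ract M)) -tensm_compl lact_ext_mul tensm_compl.
  rewrite !compA lractA tensm_compr -(compA _ (eqm _)) tensmAl -!compA.
  by rewrite eqm_comp eqm_id comp_idr.
- rewrite !compA -(compA (ract M)) tensm_idl_swap tensm_compl !compA ractA.
  by rewrite -tensm_id -!compA tensmAl.
Qed.

Definition free_ext (M : bimodule A) (h : hom one (bcar M)) :
    bimod_hom (free_bimod A) M :=
  exist _ (ract M \oc (lact_ext h \om idm A)) (free_ext_bimodule_morphism h).

(** Both sides send $a \otimes b$ to $(a \cdot f(1)) \cdot b = f(ab)$, so lifting the single value
    $f(1)$ through [p] suffices. *)
Lemma free_ext_lift (M N : bimodule A) (p : bimod_hom M N)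
    (f : bimod_hom (reg_bimod A) N) (h : hom one (bcar M)) :
  proj1_sig p \oc h = proj1_sig f \oc unit A ->
  bimod_comp p (free_ext h) = bimod_comp f mul_bimod.
Proof.
move=> ph; apply: bimod_hom_inj => /=.
case: (proj2_sig p) (proj2_sig f) => _ pr [_ fr].
by rewrite compA pr -compA -tensm_compl lact_ext_comp ph lact_ext_unit -fr.
Qed.

End Bimodules.

Theorem proposition4p4 (C : strict_monoidal)
    (h1 : projective (one : C)) (A : algebra C) :
  (projective (reg_bimod A : bimod_cat A) -> separable A) /\
  (forget_preserves_epi A ->
     separable A -> projective (reg_bimod A : bimod_cat A)).
Proof.
split=> [projA | forget_epi [gamma mul_gamma] M N p p_epi f].
(* Lift the identity of [A] through the multiplication. *)
- have [gamma mul_gamma] := projA _ _ _ (@mul_bimod_epi C A) (idm _).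
  by exists gamma; exact: (f_equal (@proj1_sig _ _) mul_gamma).
(* Projectivity of [one] is a statement in [C], so [p] must be epi there too. *)
- have [h ph] := h1 _ _ _ (forget_epi _ _ _ p_epi) (proj1_sig f \oc unit A).
  (* Composing with [p] gives [f] after [mul] after [gamma], which is [f]. *)
  exists (bimod_comp (free_ext h) gamma).
  rewrite [LHS]bimod_compA (free_ext_lift ph) -bimod_compA.
  by apply: bimod_hom_inj; rewrite /= mul_gamma comp_idr.
Qed.
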